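(* Let $\mathcal N,\tilde{\mathcal N}$ be arbitrary admissible algebras over $\mathbb F$, let $\pi\in\Pi(\mathcal N)$, $\tilde\pi\in\Pi(\tilde{\mathcal N})$ be arbitrary admissible projections, and put $S:=S_\pi$, $\tilde S:=S_{\tilde\pi}$. Then the algebras $\mathcal N,\tilde{\mathcal N}$ are isomorphic if and only if $S,\tilde S$ are affinely equivalent.
   Context: $\mathbb F$ is a field of characteristic $0$; all algebras are associative $\mathbb F$-algebras. An admissible algebra is a commutative nilpotent algebra $\mathcal N$ of finite dimension over $\mathbb F$ whose annihilator $\mathcal N_{[1]}=\{x\in\mathcal N:x\mathcal N=0\}$ has dimension $1$. $\Pi(\mathcal N)$ is the set of all admissible projections, i.e. linear maps $\pi=\pi^2\in\mathrm{End}(\mathcal N)$ with range $\mathcal N_{[1]}$. Put $\exp_1(x)=\sum_{k\ge1}x^k/k!$ for $x\in\mathcal N$ and $S_\pi:=\{x\in\mathcal N:\pi(\exp_1x)=0\}$. $S$ and $\tilde S$ are affinely equivalent if there is an affine isomorphism $\mathcal N\to\tilde{\mathcal N}$ mapping $S$ onto $\tilde S$. *)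

(* Defs.v *)
From HB Require Import structures.
From mathcomp Require Import all_boot all_order all_algebra.

Set Implicit Arguments.
Unset Strict Implicit.
Unset Printing Implicit Defensive.

Import GRing.Theory.

Local Open Scope ring_scope.

(* Finite-dimensional associative algebras without unit: the algebra
   structures of ssralg.v and falgebra.v are all unital, hence cannot carry a
   nilpotent product. *)
HB.mixin Record Vector_isAssocAlg (F : fieldType) A of Vector F A := {
  amul : A -> A -> A;
  amulA : associative amul;
  amulDl : left_distributive amul +%R;
  amulDr : right_distributive amul +%R;
  amulZl : forall (a : F) (x y : A), amul (a *: x) y = a *: amul x y;
  amulZr : forall (a : F) (x y : A), amul x (a *: y) = a *: amul x y
}.

#[short(type="assocAlgType")]
HB.structure Definition AssocAlg (F : fieldType) :=
  { A of Vector_isAssocAlg F A & Vector F A }.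

Notation "x ** y" := (amul x y) (at level 40, left associativity) : ring_scope.

Section AssocAlg.

Variables (F : fieldType) (N : assocAlgType F).
Implicit Types (x y : N) (k n : nat).

(* x ^ k for k >= 1; the value at k = 0 is junk, there being no unit. *)
Definition apow x k : N := iter k.-1 (amul x) x.

(* N ^ (n + 1) = 0 for some n: all products of n + 1 factors vanish. *)
Definition nilpotent_alg : Prop :=
  exists n, forall x (s : seq N), size s = n -> foldl amul x s = 0.

Definition lmul x : 'End(N) := linfun (amul x).

(* The annihilator, as the kernel of x |-> (y |-> x ** y); see annihilatorP. *)
Definition annihilator : {vspace N} := lker (linfun lmul).

Definition admissible : Prop :=
  [/\ commutative (@amul F N), nilpotent_alg & \dim annihilator = 1%N].

Definition admissible_proj (p : 'End(N)) : Prop :=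
  (p \o p)%VF = p /\ limg p = annihilator.

(* In a nilpotent algebra of dimension d all powers x ^ k with k > d vanish,
   so that this is the full series \sum_(k >= 1) x ^ k / k!; see exp1E. *)
Definition exp1 x : N :=
  \sum_(1 <= k < (\dim {:N}).+1) (k`!%:R : F)^-1 *: apow x k.

Definition Sset (p : 'End(N)) : {pred N} := [pred x | p (exp1 x) == 0].

Fact amul_is_linear x : linear (amul x).
Proof. by move=> a y z; rewrite amulDr amulZr. Qed.

HB.instance Definition _ x :=
  GRing.isLinear.Build F N N *:%R (amul x) (amul_is_linear x).

Lemma lmulE x y : lmul x y = x ** y.
Proof. exact: lfunE. Qed.

Fact lmul_is_linear : linear lmul.
Proof.
move=> a x y; apply/lfunP => z.
by rewrite add_lfunE scale_lfunE !lmulE amulDl amulZl.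
Qed.

HB.instance Definition _ :=
  GRing.isLinear.Build F N 'End(N) *:%R lmul lmul_is_linear.

Lemma annihilatorP x : reflect (forall y, x ** y = 0) (x \in annihilator).
Proof.
rewrite memv_ker lfunE; apply: (iffP eqP) => [x0 y | x0].
  by rewrite -lmulE x0 zero_lfunE.
by apply/lfunP => y; rewrite lmulE x0 zero_lfunE.
Qed.

Lemma foldl_amul x y (s : seq N) :
  foldl amul (x ** y) s = x ** foldl amul y s.
Proof. by elim: s y => //= z s IHs y; rewrite -amulA IHs. Qed.

Lemma foldl_nseq x k : foldl amul x (nseq k x) = apow x k.+1.
Proof. by elim: k => //= k IHk; rewrite foldl_amul IHk. Qed.

Lemma iter_amul x y k : iter k.+1 (amul x) y = apow x k.+1 ** y.
Proof. by elim: k => //= k ->; rewrite amulA. Qed.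

Lemma apow_eq0 x k : nilpotent_alg -> (\dim {:N} < k)%N -> apow x k = 0.
Proof.
move=> [n nilN]; pose U j := iter j (fun V => lmul x @: V)%VS fullv.
have Ux j y : iter j (amul x) y \in U j.
  by elim: j => [|j IHj]; rewrite ?memvf //= -lmulE memv_img.
have US j : (U j.+1 <= U j)%VS.
  by elim: j => [|j IHj]; [exact: subvf | exact: limgS].
have U0 : U n.+1 = 0%VS.
  have Ui j z : z \in U j -> exists y, z = iter j (amul x) y.
    elim: j z => [|j IHj] z /=; first by exists z.
    by case/memv_imgP=> _ /IHj[y ->] ->; exists y; rewrite lmulE.
  apply/eqP; rewrite -subv0; apply/subvP=> _ /Ui[y ->].
  rewrite iter_amul -foldl_nseq nilN ?size_nseq // -lmulE.
  by rewrite (linear0 lmul) zero_lfunE memv0.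
have stat j : U j.+1 = U j -> U j = 0%VS.
  move=> Uj; have Ui i : U (i + j)%N = U j.
    by elim: i => //= i IHi; rewrite -[LHS]/(lmul x @: U (i + j)%N)%VS IHi.
  have Unj i : U (i + n.+1)%N = 0%VS.
    by elim: i => //= i; rewrite /U /= => ->; rewrite limg0.
  by rewrite -(Ui n.+1) addnC.
have Udim j : (\dim (U j) <= \dim {:N} - j)%N.
  elim: j => [|j IHj]; first by rewrite subn0.
  have [Uj|Uj] := eqVneq (U j.+1) (U j).
    by rewrite Uj (stat _ Uj) dimv0.
  rewrite subnS -ltnS; apply: (@leq_trans (\dim (U j))).
    by rewrite ltn_neqAle (dimv_leqif_eq (US j)) Uj dimvS.
  by apply: leq_trans IHj (leqSpred _).
case: k => // k lek; apply/eqP.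
have := Udim k; rewrite (eqP (_ : \dim {:N} - k == 0)%N) ?subn_eq0 //.
by rewrite leqn0 dimv_eq0 => /eqP Uk; rewrite -memv0 -Uk Ux.
Qed.

Lemma exp1E x n : nilpotent_alg -> (\dim {:N} <= n)%N ->
  exp1 x = \sum_(1 <= k < n.+1) (k`!%:R : F)^-1 *: apow x k.
Proof.
move=> nilN len; rewrite [RHS](big_cat_nat _ (n := (\dim {:N}).+1)) //=.
rewrite [X in _ + X]big_nat_cond [X in _ + X]big1 ?addr0 // => k.
by rewrite andbT => /andP[ltk _]; rewrite apow_eq0 ?scaler0.
Qed.

End AssocAlg.

Definition alg_isomorphic (F : fieldType) (N N' : assocAlgType F) : Prop :=
  exists2 f : {linear N -> N'}, bijective f & {morph f : x y / x ** y}.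

Definition affine_iso (F : fieldType) (V W : vectType F) (g : V -> W) : Prop :=
  bijective g /\ exists (f : {linear V -> W}) (b : W), forall x, g x = f x + b.

Definition affinely_equivalent (F : fieldType) (V W : vectType F)
    (S : {pred V}) (T : {pred W}) : Prop :=
  exists2 g : V -> W, affine_iso g &
    forall y, y \in T <-> exists2 x, x \in S & y = g x.

(* Main.v *)
(* Write p x = l x *: a with a spanning the annihilator and l a = 1, so that
   S is the zero set of x |-> l (exp1 x).
   If N and N' are isomorphic we may take N = N'.  Since (x, y) |-> l (x ** y) is
   nondegenerate modulo the annihilator, any other normalized functional is
   l ((1 + c) ** _), and 1 + c = exp b; as exp is multiplicative, the two zero
   sets are translates of each other.
   Conversely, moving the origin of S' replaces m by m (exp b ** _), so the affine
   equivalence may be taken to be a linear map f.  Since S is a graph in the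
   direction a, l (exp1 x) divides m (exp1 (f x)), and vice versa by symmetry;
   the cofactors are units, hence m (exp1 (f x)) = c * l (exp1 x).  Comparing the
   parts of degree 1, 2 and 3 gives m (f x) = c * l x,
   m (f x ** f y) = c * l (x ** y) and
   m (f x ** f y ** f z) = c * l (x ** y ** z), whence f x ** f y - f (x ** y) is
   in the annihilator and in the kernel of m, i.e. vanishes. *)
From HB Require Import structures.
From mathcomp Require Import all_boot all_order all_algebra.
Require Import Defs.

Set Implicit Arguments.
Unset Strict Implicit.
Unset Printing Implicit Defensive.

Import GRing.Theory.
Local Open Scope ring_scope.

(** * Adjoining a unit to a nilpotent algebra *)

Definition unitization (F : fieldType) (N : assocAlgType F) : Type :=
  (F^o * N)%type.

Section Unitization.

Variables (F : fieldType) (N : assocAlgType F).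

HB.instance Definition _ :=
  GRing.Lmodule.copy (unitization N) (F^o * N)%type.

Implicit Types u v w : unitization N.

(** A pair is read as the sum [u.1 + u.2]. With a unit, ring powers, the binomial formula and
    polynomials become available. *)
Definition umul u v : unitization N :=
  (u.1 * v.1, (u.1 : F) *: v.2 + (v.1 : F) *: u.2 + u.2 ** v.2).
Definition uone : unitization N := (1, 0).

Fact amul0x (x : N) : 0 ** x = 0.
Proof. by rewrite -[X in X ** _](scale0r 0) amulZl scale0r. Qed.

Fact amulx0 (x : N) : x ** 0 = 0. Proof. exact: linear0. Qed.

Fact amulNl (x y : N) : - x ** y = - (x ** y).
Proof. by rewrite -scaleN1r amulZl scaleN1r. Qed.

Fact amulNr (x y : N) : x ** - y = - (x ** y). Proof. exact: linearN. Qed.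

Fact umulA : associative umul.
Proof.
move=> [a x] [b y] [c z]; congr pair => /=; first exact: mulrA.
rewrite !amulDl !amulDr !amulZl !amulZr !scalerDr !scalerA amulA !addrA.
by rewrite [LHS](ACl (1*2*4*6*3*5*7))%AC /= (mulrC c a) (mulrC c b).
Qed.

Fact umul1x : left_id uone umul.
Proof.
by move=> [a x]; congr pair; rewrite /= ?mul1r // scale1r scaler0 amul0x !addr0.
Qed.

Fact umulx1 : right_id uone umul.
Proof.
by move=> [a x]; congr pair; rewrite /= ?mulr1 // scale1r scaler0 amulx0 addr0 add0r.
Qed.

Fact umulDl : left_distributive umul +%R.
Proof.
move=> [a x] [b y] [c z]; congr pair => /=; first exact: mulrDl.
by rewrite amulDl scalerDl scalerDr; rewrite [RHS]addrACA; congr (_ + _); exact: addrACA.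
Qed.

Fact umulDr : right_distributive umul +%R.
Proof.
move=> [a x] [b y] [c z]; congr pair => /=; first exact: mulrDr.
by rewrite amulDr scalerDl scalerDr; rewrite [RHS]addrACA; congr (_ + _); exact: addrACA.
Qed.

Fact uone_neq0 : uone != 0.
Proof. by apply/eqP=> -[/eqP]; rewrite oner_eq0. Qed.

HB.instance Definition _ := GRing.Zmodule_isNzRing.Build (unitization N)
  umulA umul1x umulx1 umulDl umulDr uone_neq0.

Lemma umul_scale a b u v : (a *: u) * (b *: v) = (a * b) *: (u * v).
Proof.
case: u v => [c x] [d y]; congr pair; first exact: mulrACA.
rewrite /= amulZl amulZr !scalerDr !scalerA.
congr (_ *: _ + _ *: _ + _); first exact: mulrAC.
by rewrite [LHS]mulrC; exact: mulrA.
Qed.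

Definition uinj (x : N) : unitization N := (0, x).

Lemma uinjX x k : (0 < k)%N -> uinj x ^+ k = uinj (apow x k).
Proof.
case: k => // k _; elim: k => // k IHk; rewrite exprS IHk.
congr pair; first exact: mul0r.
by rewrite /= !scale0r !add0r.
Qed.


Lemma uinj_comm x y : x ** y = y ** x -> GRing.comm (uinj x) (uinj y).
Proof.
by move=> xyC; rewrite /GRing.comm; congr pair; rewrite /= ?scale0r ?xyC.
Qed.

Lemma uinjD x y : uinj (x + y) = uinj x + uinj y.
Proof. by congr pair; rewrite /= addr0. Qed.

End Unitization.

(** * The exponential map: functional equation and surjectivity *)

Section Exp.

Variables (F : fieldType) (N : assocAlgType F).
Implicit Types x y a r : N.
Hypotheses (charF0 : [pchar F]%R =i pred0).
Hypotheses (amulC : commutative (@amul F N)) (nilN : nilpotent_alg N).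

Let fact_neq0 k : k`!%:R != 0 :> F.
Proof. by move/pcharf0P: charF0 ->; rewrite -lt0n fact_gt0. Qed.

(* The exponential series, as a polynomial whose k-th coefficient is
   [x ^ k / k!], so that the product of polynomials is the Cauchy product. *)
Let uexp (x : N) : {poly unitization N} :=
  \poly_(i < (\dim {:N}).+1) ((i`!%:R : F)^-1 *: uinj x ^+ i).

Let coef_uexp x i : (uexp x)`_i = (i`!%:R : F)^-1 *: uinj x ^+ i.
Proof.
rewrite coef_poly ltnS; case: leqP => // ltni.
(* Past the truncation the coefficient is 0 on both sides, by nilpotency. *)
rewrite uinjX ?(leq_ltn_trans _ ltni) // apow_eq0 //.
by symmetry; exact: (scaler0 (unitization N)).
Qed.

Let uexp1 x : (uexp x).[1] = 1 + uinj (exp1 x).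
Proof.
rewrite horner_poly big_ord_recl fact0 invr1 scale1r expr0 mulr1.
congr (_ + _); rewrite /exp1 big_add1 big_mkord.
rewrite (@big_morph _ _ (@uinj F N) 0 +%R 0 +%R (@uinjD F N)) //.
apply: eq_bigr => i _; rewrite lift0 expr1n mulr1 uinjX //.
by congr pair; exact: mulr0.
Qed.

Let uexpD x y : uexp x * uexp y = uexp (x + y).
Proof.
apply/polyP => k; rewrite coefM coef_uexp uinjD.
rewrite exprDn_comm; last exact/uinj_comm/amulC.
rewrite scaler_sumr [RHS](reindex_inj rev_ord_inj) /=.
apply: eq_bigr => j _; have lejk : (j <= k)%N by rewrite -ltnS.
rewrite !coef_uexp umul_scale subSS subKn // bin_sub // -scaler_nat scalerA.
congr (_ *: _); apply: (mulfI (fact_neq0 k)); rewrite mulVKf ?fact_neq0 //.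
by rewrite -(bin_fact lejk) !natrM -mulrA mulrACA !divff ?mulr1 ?fact_neq0.
Qed.

(** This is [exp (x + y) = exp x * exp y] with [exp = 1 + exp1]: the Cauchy product of the two
    series, evaluated at 1. *)
Lemma exp1D x y : exp1 (x + y) = exp1 x + exp1 y + exp1 x ** exp1 y.
Proof.
have: (uexp x).[1] * (uexp y).[1] = (uexp (x + y)).[1].
  by rewrite -uexpD hornerM_comm // /comm_poly mulr1 mul1r.
rewrite !uexp1 mulrDl !mulrDr !mul1r mulr1 -!addrA => /addrI/(congr1 snd) /= <-.
by rewrite !scale0r !add0r addrCA addrA.
Qed.

Lemma apow0 k : apow (0 : N) k = 0.
Proof. by case: k => [|[|k]] //; exact: amul0x. Qed.

Lemma apowS x k : (0 < k)%N -> apow x k.+1 = x ** apow x k.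
Proof. by case: k. Qed.

Lemma apowZ (t : F) x k : (0 < k)%N -> apow (t *: x) k = t ^+ k *: apow x k.
Proof.
case: k => // k _; elim: k => [|k IHk]; first by rewrite expr1.
by rewrite !(apowS _ (ltn0Sn k)) IHk amulZl amulZr scalerA -exprS.
Qed.

Lemma exp10 : exp1 (0 : N) = 0.
Proof. by apply: big1 => k _; rewrite apow0 scaler0. Qed.

Lemma exp1_factor x : exists w, exp1 x = x + x ** w.
Proof.
rewrite (exp1E x nilN (leqnSn _)) big_ltn // factS fact0 invr1 scale1r.
exists (\sum_(2 <= k < (\dim {:N}).+2) (k`!%:R : F)^-1 *: apow x k.-1).
rewrite linear_sum; congr (_ + _); rewrite big_nat [RHS]big_nat.
apply: eq_bigr => -[|[|k]] // _.
by rewrite [RHS]linearZ.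
Qed.

Lemma exp1_ann a : a \in annihilator N -> exp1 a = a.
Proof. by move/annihilatorP=> a0; have [w ->] := exp1_factor a; rewrite a0 addr0. Qed.

Lemma exp1D_ann x a : a \in annihilator N -> exp1 (x + a) = exp1 x + a.
Proof.
by move=> Aa; rewrite exp1D (exp1_ann Aa) amulC (annihilatorP _ Aa) addr0.
Qed.

(* [1 + r = exp r * (1 + r')] where r' is a multiple of r ^ 2, hence lies one
   step lower in the upper annihilator series. *)
Lemma exp1_surj r : exists x, exp1 x = r.
Proof.
have [n nil_n] := nilN.
have: forall s, size s = n -> foldl amul r s = 0 by move=> s; exact: nil_n.
elim: n r {nil_n} => [|n IHn] r kill_r.
  by exists 0; rewrite exp10 -(kill_r [::]).
have [w Ew] := exp1_factor (- r).
(* Chosen so that [1 + r' = exp (- r) * (1 + r)]. *)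
set r' := exp1 (- r) + r + exp1 (- r) ** r.
have [|b Eb] := IHn r'.
  have ->: r' = r ** (- w - r - w ** r).
    rewrite /r' Ew [X in X + _]addrAC addNr add0r amulDl !amulDr !amulNl.
    by rewrite !amulNr amulA addrA.
  by move=> s sz_s; apply: (kill_r (_ :: s)); rewrite /= sz_s.
exists (r + b); rewrite exp1D Eb.
have := exp1D r (- r); rewrite subrr exp10 => E0.
rewrite /r' !amulDr amulA !addrA [LHS](ACl ((1*2*5)*3*(6*4*7)))%AC /=.
by rewrite -!amulDl -E0 amul0x add0r addr0.
Qed.

End Exp.

(** * Polynomial functions, tested on lines *)

Section Polynomials.

Variable F : fieldType.
Hypothesis charF0 : [pchar F]%R =i pred0.

Lemma natr_inj : injective (fun n => n%:R : F).
Proof.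
move=> m n; wlog lemn: m n / (m <= n)%N => [IH|] eq_mn.
  by case/orP: (leq_total m n) => ?; [|symmetry]; apply: IH.
apply/eqP; rewrite eqn_leq lemn -subn_eq0 /=.
by rewrite -(proj1 (pcharf0P F) charF0) natrB // eq_mn subrr.
Qed.

(** The values 1, 2, 3, ... are distinct and nonzero in characteristic 0. Leaving out [t = 0]
    matters for the cofactor identity, first known only off the zero set. *)
Lemma poly_ext (P Q : {poly F}) :
  (forall t : F, t != 0 -> P.[t] = Q.[t]) -> P = Q.
Proof.
move=> eqPQ; apply/eqP; rewrite -subr_eq0; apply/negPn/negP => nz.
pose rs := [seq (n.+1)%:R : F | n <- iota 0 (size (P - Q)%R)].
have: (size rs < size (P - Q)%R)%N.
  apply: max_poly_roots => //.
    apply/allP=> _ /mapP[n _ ->]; rewrite rootE hornerD hornerN eqPQ ?subrr //.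
    by rewrite (proj1 (pcharf0P F) charF0).
  by rewrite map_inj_uniq ?iota_uniq // => m n /natr_inj[].
by rewrite size_map size_iota ltnn.
Qed.

(** A coordinate-free substitute for polynomial functions; restrictions to lines suffice to compare
    units. *)
Definition linewise_poly (V : lmodType F) (h : V -> F) : Prop :=
  forall x y, exists P : {poly F}, forall t, h (x + t *: y) = P.[t].

Section Linewise.

Variable V : lmodType F.
Implicit Types g h : V -> F.

Lemma linewiseM g h :
  linewise_poly g -> linewise_poly h -> linewise_poly (fun x => g x * h x).
Proof.
move=> gP hP x y; have [P EP] := gP x y; have [Q EQ] := hP x y.
by exists (P * Q) => t; rewrite hornerM EP EQ.
Qed.

Lemma linewiseX h n : linewise_poly h -> linewise_poly (fun x => h x ^+ n).
Proof.
by move=> hP x y; have [P EP] := hP x y; exists (P ^+ n) => t; rewrite horner_exp EP.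
Qed.

Lemma linewise_sum n (g : 'I_n -> V -> F) :
  (forall i, linewise_poly (g i)) -> linewise_poly (fun x => \sum_(i < n) g i x).
Proof.
elim: n g => [|n IHn] g gP x y.
  by exists 0 => t; rewrite big_ord0 horner0.
have [P EP] := gP ord0 x y; have [Q EQ] := IHn _ (fun i => gP (lift ord0 i)) x y.
by exists (P + Q) => t; rewrite hornerD big_ord_recl EP EQ.
Qed.

Lemma linewise_comp (U : lmodType F) (f : {linear U -> V}) h :
  linewise_poly h -> linewise_poly (h \o f).
Proof.
move=> hP x y; have [P EP] := hP (f x) (f y).
by exists P => t; rewrite /= linearD linearZ EP.
Qed.

(* On every line the two polynomials are inverse units of F[t]. *)
Lemma linewise_unit_const g h : linewise_poly g -> linewise_poly h ->
  (forall x, g x * h x = 1) -> forall x y, g x = g y.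
Proof.
move=> gP hP gh x y; have [P EP] := gP x (y - x); have [Q EQ] := hP x (y - x).
have PQ : P * Q = 1.
  by apply: poly_ext => t _; rewrite hornerM -EP -EQ gh hornerC.
have /size_poly1P[c _ Ec] : size P == 1%N.
  by have := size_mul_eq1 P Q; rewrite PQ size_poly1 eqxx => /esym/andP[].
have := EP 0; have := EP 1; rewrite Ec !hornerC scale0r scale1r addr0.
by rewrite addrC subrK => -> ->.
Qed.

End Linewise.

End Polynomials.

(** * Functionals restricting to a coordinate on the annihilator *)

Section Functionals.

Variables (F : fieldType) (N : assocAlgType F).
Implicit Types (x y a : N) (l : 'Hom(N, F^o)).

Definition normalized l a : Prop :=
  [/\ a \in annihilator N, l a = 1 &
      forall x, x \in annihilator N -> x = (l x : F) *: a].

Lemma admissible_functional (p : 'End(N)) : admissible N -> admissible_proj p ->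
  exists l a, normalized l a /\ (forall x, (x \in Sset p) = (l (exp1 x) == 0)).
Proof.
move=> [_ _ dimA] [pp imp]; pose a := vpick (annihilator N).
have a_neq0 : a != 0 by rewrite vpick0 -dimv_eq0 dimA.
have Aa : annihilator N = <[a]>%VS.
  by apply/esym/eqP; rewrite eqEdim dim_vline a_neq0 dimA -memvE memv_pick.
have freea : free [tuple a] by rewrite seq1_free.
have coorda c : coord [tuple a] ord0 (c *: a) = c.
  have ca1 : coord [tuple a] ord0 a = 1 by exact: (coord_free ord0 ord0 freea).
  by rewrite linearZ /= ca1 [LHS]mulr1.
pose l := (linfun (coord [tuple a] ord0 : N -> F^o) \o p)%VF.
have lE x : p x = (l x : F) *: a.
  have: p x \in <[a]>%VS by rewrite -Aa -imp memv_img ?memvf.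
  by case/vlineP=> c Ec; rewrite comp_lfunE lfunE /= Ec coorda.
have pA x : x \in annihilator N -> p x = x.
  by rewrite -imp => /memv_imgP[y _ ->]; rewrite -comp_lfunE pp.
have AA : a \in annihilator N by exact: memv_pick.
exists l, a; split=> [|x]; first split=> // [|x Ax].
- by rewrite -[RHS](coorda 1) scale1r comp_lfunE lfunE /= pA.
- by rewrite -lE pA.
by rewrite inE lE scaler_eq0 (negPf a_neq0) orbF.
Qed.

Definition mulfun l c : 'Hom(N, F^o) := (l \o lmul c)%VF.

Fact mulfun_is_linear l : linear (mulfun l).
Proof.
move=> k c d; apply/lfunP => x.
by rewrite add_lfunE scale_lfunE !comp_lfunE !lmulE amulDl amulZl linearP.
Qed.

HB.instance Definition _ l :=
  GRing.isLinear.Build F N 'Hom(N, F^o) *:%R (mulfun l) (mulfun_is_linear l).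

Hypotheses (amulC : commutative (@amul F N)) (nilN : nilpotent_alg N).

(* A counterexample could be multiplied into the annihilator, where [l] is
   injective. *)
Lemma functional_nondegenerate l a x : normalized l a ->
  (forall y, l (x ** y) = 0) -> x \in annihilator N.
Proof.
move=> [_ _ lA] lx; have [n nil_n] := nilN.
have: forall s, size s = n -> foldl amul x s = 0 by move=> s; exact: nil_n.
elim: n x lx {nil_n} => [|n IHn] x lx kill_x; apply/annihilatorP => y.
  by rewrite [x](kill_x [::]) ?amul0x.
rewrite (lA (x ** y)) ?lx ?scale0r //; apply: IHn => [z|s sz_s].
  by rewrite -amulA lx.
by apply: (kill_x (y :: s)); rewrite /= sz_s.
Qed.

(** A dimension count. The kernel of [c |-> l (c ** _)] lies in the annihilator, so the image has
    codimension at most 1. It misses [l], since its members vanish at [a]; so it spans the dual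
    together with [l], and [m a = 0] kills the [l]-component. *)
Lemma functional_representation l a (m : 'Hom(N, F^o)) : normalized l a ->
  \dim (annihilator N) = 1%N -> m a = 0 -> exists c, forall x, m x = l (c ** x).
Proof.
move=> la dimA ma; have [Aa la1 lA] := la.
pose T : 'Hom(N, 'Hom(N, F^o)) := linfun (mulfun l).
have TE c x : T c x = l (c ** x) by rewrite lfunE /= comp_lfunE lmulE.
have kerT : (lker T <= annihilator N)%VS.
  apply/subvP=> c; rewrite memv_ker => /eqP Tc0.
  by apply: functional_nondegenerate la _ => y; rewrite -TE Tc0 zero_lfunE.
have notTl : l \notin limg T.
  apply/memv_imgP=> -[c _ El]; move/eqP: la1.
  by rewrite El TE amulC (annihilatorP _ Aa) linear0 eq_sym oner_eq0.
have full : (limg T + <[l]>)%VS = fullv.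
  apply/eqP; rewrite eqEdim subvf /=.
  have ltT : (\dim (limg T) < \dim (limg T + <[l]>))%N.
    rewrite ltnNge; apply/negP => le_dim; case/negP: notTl.
    have /eqP-> : limg T == (limg T + <[l]>)%VS by rewrite eqEdim addvSl.
    by rewrite memvE addvSr.
  apply: leq_trans ltT.
  have := limg_ker_dim T fullv; rewrite capfv => dimT.
  have -> : \dim {: 'Hom(N, F^o)} = \dim {: N} by rewrite !dimvf /dim /= muln1.
  by rewrite -dimT -addn1 addnC leq_add2l -dimA dimvS.
have /memv_addP[_ /memv_imgP[c _ ->] [_ /vlineP[k ->] Em]] :
  m \in (limg T + <[l]>)%VS by rewrite full memvf.
have k0 : k = 0.
  move: ma; rewrite Em add_lfunE TE amulC (annihilatorP _ Aa) linear0 add0r.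
  by rewrite scale_lfunE la1 => k1; rewrite -[k]mulr1.
by exists c => x; rewrite Em k0 scale0r addr0 TE.
Qed.

End Functionals.

(** * The exponential along a line *)

Section ExpOnLines.

Variables (F : fieldType) (N : assocAlgType F).
Hypotheses (charF0 : [pchar F]%R =i pred0).
Hypotheses (amulC : commutative (@amul F N)) (nilN : nilpotent_alg N).
Implicit Types (x y : N) (l : 'Hom(N, F^o)).

(** The expansion of [exp x * exp (t *: y)] in [t]. The bound exceeds the degree by enough that the
    coefficient of [t] is present even in dimension 0. *)
Definition exp1_line l x y : {poly F} :=
  \poly_(k < (\dim {:N}).+2)
    (if k == 0%N then l (exp1 x)
     else (k`!%:R : F)^-1 * l (apow y k + exp1 x ** apow y k)).

Lemma horner_exp1_line l x y t : (exp1_line l x y).[t] = l (exp1 (x + t *: y)).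
Proof.
rewrite horner_poly big_ord_recl /= mulr1.
rewrite exp1D // -addrA linearD; congr (_ + _).
rewrite (exp1E (t *: y) nilN (leqnSn _)) big_add1 big_mkord /=.
rewrite linear_sum -big_split linear_sum; apply: eq_bigr => i _.
rewrite -[bump 0 i]/(i.+1) /= apowZ // !amulZr -!scalerDr !linearZ /=.
by rewrite -[RHS]/(_ * (_ * _)) -mulrA; congr (_ * _); exact: mulrC.
Qed.

Lemma linewise_exp1 l : linewise_poly (fun x => l (exp1 x) : F).
Proof. by move=> x y; exists (exp1_line l x y) => t; rewrite horner_exp1_line. Qed.

End ExpOnLines.

(** * Linear maps relating two exponential equations *)

Section LinearEquivalence.

Variables (F : fieldType) (N N' : assocAlgType F).
Hypotheses (charF0 : [pchar F]%R =i pred0).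
Hypotheses (amulC : commutative (@amul F N)) (nilN : nilpotent_alg N).
Hypotheses (amulC' : commutative (@amul F N')) (nilN' : nilpotent_alg N').
Implicit Types (f : {linear N -> N'}) (l : 'Hom(N, F^o)) (m : 'Hom(N', F^o)).

(* [x - l (exp1 x) *: a] lies on the zero set, so [- l (exp1 x)] is a root of
   the polynomial [s |-> m (exp1 (f x + s *: f a))]; [h x] is the cofactor. *)
Lemma exp1_functional_dvd f l a m : normalized l a ->
  (forall x, l (exp1 x) = 0 -> m (exp1 (f x)) = 0) ->
  exists2 h : N -> F, linewise_poly h &
    forall x, m (exp1 (f x)) = h x * l (exp1 x).
Proof.
move=> [Aa la1 _] lm.
pose P x := exp1_line m (f x) (f a).
(* With [q = l (exp1 x)], the root [- q] of [P x] expresses its constant term [m (exp1 (f x))] as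
   [q] times this sum. *)
exists (fun x => \sum_(i < (\dim {:N'}).+1) (P x)`_i.+1 * (- (l (exp1 x) : F)) ^+ i).
  apply: linewise_sum => i; apply: linewiseM; last first.
    apply: linewiseX => x y; have [Q EQ] := linewise_exp1 charF0 amulC nilN l x y.
    by exists (- Q) => t; rewrite hornerN EQ.
  (* The coefficient of index [i.+1] depends on [x] only through [m' (exp1 (f x))]. *)
  pose b := apow (f a) i.+1; pose m' : 'Hom(N', F^o) := (m \o lmul b)%VF.
  pose k := (i.+1`!%:R : F)^-1.
  move=> x y; have [Q EQ] := linewise_comp f (linewise_exp1 charF0 amulC' nilN' m') x y.
  exists (k *: ((m b : F)%:P + Q)) => t.
  rewrite hornerZ hornerD hornerC -EQ /= coef_poly ltnS ltn_ord /=.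
  by rewrite linearD comp_lfunE lmulE [b ** _]amulC'.
move=> x; set q : F := l (exp1 x).
have Pq : (P x).[- q] = 0.
  rewrite horner_exp1_line // -linearZ -linearD lm //.
  rewrite exp1D_ann ?memvZ // linearD linearZ /= la1.
  by rewrite -[_ *: _]/(- q * 1) mulr1 subrr.
have P0 : (P x)`_0 = m (exp1 (f x)) by rewrite coef_poly.
move: Pq; rewrite (@horner_coef_wide _ (\dim {:N'}).+2) ?size_poly //.
rewrite big_ord_recl mulr1 P0 => /eqP; rewrite addr_eq0 => /eqP ->.
rewrite mulr_suml -sumrN; apply: eq_bigr => i _.
by rewrite lift0 exprSr mulrA mulrN opprK.
Qed.

(* The coefficients of [t] in the two sides at [x + t *: y]. *)
Lemma exp1_functional_deriv f l m :
  (forall x, m (exp1 (f x)) = l (exp1 x)) ->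
  forall x y, m (f y + exp1 (f x) ** f y) = l (y + exp1 x ** y).
Proof.
move=> ml x y; have: exp1_line m (f x) (f y) = exp1_line l x y.
  apply: (poly_ext charF0) => t _.
  by rewrite !horner_exp1_line // -ml linearD linearZ.
move/(congr1 (fun p : {poly F} => p`_1)); rewrite !coef_poly /=.
by rewrite factS fact0 invr1 !mul1r.
Qed.

(** The second identity has the shape of the hypothesis, for [m (f y ** _)] and [l (y ** _)].
    Iterating thus reaches degrees 2 and 3 with first-order coefficients only. *)
Lemma exp1_functional_eq f l m : (forall x, m (exp1 (f x)) = l (exp1 x)) ->
  (forall y, m (f y) = l y) /\
  (forall y x, m (f y ** exp1 (f x)) = l (y ** exp1 x)).
Proof.
move/exp1_functional_deriv => E.
have E0 y : m (f y) = l y.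
  by have := E 0 y; rewrite linear0 !exp10 !amul0x !addr0.
split=> // y x; have := E x y.
by rewrite !linearD /= E0 => /addrI; rewrite amulC' [_ ** y]amulC.
Qed.

Lemma exp1_functional_morph f (g : N' -> N) m a' :
  cancel g f -> normalized m a' ->
  (exists l : 'Hom(N, F^o), forall x, m (exp1 (f x)) = l (exp1 x)) ->
  {morph f : x y / x ** y}.
Proof.
move=> gK ma' [l /exp1_functional_eq[E1 D1]].
have [_ _ mA'] := ma'.
have E2 x y : m (f x ** f y) = l (x ** y).
  have [w|+ _] := @exp1_functional_eq f (l \o lmul x)%VF (m \o lmul (f x))%VF.
    by rewrite !comp_lfunE !lmulE D1.
  by move=> /(_ y); rewrite !comp_lfunE !lmulE.
have D2 x y z : m (f x ** f y ** exp1 (f z)) = l (x ** y ** exp1 z).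
  have [w|_ +] := @exp1_functional_eq f (l \o lmul x)%VF (m \o lmul (f x))%VF.
    by rewrite !comp_lfunE !lmulE D1.
  by move=> /(_ y z); rewrite !comp_lfunE !lmulE !amulA.
have E3 x y z : m (f x ** f y ** f z) = l (x ** y ** z).
  have [w|+ _] := @exp1_functional_eq f (l \o lmul (x ** y))%VF
    (m \o lmul (f x ** f y))%VF.
    by rewrite !comp_lfunE !lmulE D2.
  by move=> /(_ z); rewrite !comp_lfunE !lmulE.
move=> x y; apply/esym/eqP; rewrite -subr_eq0; apply/eqP.
rewrite (mA' (f x ** f y - f (x ** y))).
  by rewrite linearB /= E2 E1 subrr scale0r.
(* Since [f] is onto, testing against [w = f (g w)] is enough. *)
apply: (functional_nondegenerate nilN' ma') => w.
by rewrite -[w]gK amulDl amulNl linearB /= E3 E2 subrr.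
Qed.

End LinearEquivalence.

(** * Equal zero sets force proportional equations *)

Section Proportional.

Variables (F : fieldType) (N N' : assocAlgType F).
Hypotheses (charF0 : [pchar F]%R =i pred0).
Hypotheses (amulC : commutative (@amul F N)) (nilN : nilpotent_alg N).
Hypotheses (amulC' : commutative (@amul F N')) (nilN' : nilpotent_alg N').
Implicit Types (f : {linear N -> N'}) (l : 'Hom(N, F^o)) (m : 'Hom(N', F^o)).

Lemma exp1_functional_proportional f (g : {linear N' -> N}) l a m a' :
  cancel f g -> cancel g f -> normalized l a -> normalized m a' ->
  (forall x, l (exp1 x) = 0 <-> m (exp1 (f x)) = 0) ->
  exists c : F, forall x, m (exp1 (f x)) = c * l (exp1 x).
Proof.
move=> fK gK la ma' lm; have [Aa la1 _] := la.
have [h hP Eh] := exp1_functional_dvd charF0 amulC nilN amulC' nilN' la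
  (fun x => proj1 (lm x)).
have [|h' h'P Eh'] := exp1_functional_dvd charF0 amulC' nilN' amulC nilN
  (f := g) (m := l) ma'.
  by move=> y; rewrite -{1}[y]gK => /lm.
have hh'0 x : l (exp1 x) != 0 -> h x * h' (f x) = 1.
  move=> lx; apply: (mulIf lx).
  by rewrite mulrAC -Eh mulrC -Eh' fK mul1r.
have h'fP := linewise_comp f h'P.
have hh' x : h x * (h' \o f) x = 1.
  (* Along [x - q *: a + t *: a] the value of [l \o exp1] is [t], so the identity holds for [t != 0]
     and extends to all [t]; [t = q] gives [x]. *)
  pose q : F := l (exp1 x).
  have [P EP] := hP (x - q *: a) a; have [Q EQ] := h'fP (x - q *: a) a.
  have PQ : P * Q = 1.
    apply: (poly_ext charF0) => t t_neq0; rewrite hornerM -EP -EQ hornerC hh'0 //.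
    rewrite -addrA -scaleNr -scalerDl exp1D_ann ?memvZ // linearD linearZ /= la1.
    by rewrite -[_ *: _]/((- q + t) * 1) mulr1 addNKr.
  by rewrite -[x](subrK (q *: a)) EP EQ -hornerM PQ hornerC.
exists (h 0) => x.
by rewrite Eh (linewise_unit_const charF0 hP h'fP hh' x 0).
Qed.

End Proportional.

(** * Translations and changes of functional *)

Section Translation.

Variables (F : fieldType) (N : assocAlgType F).
Hypotheses (charF0 : [pchar F]%R =i pred0).
Hypotheses (amulC : commutative (@amul F N)) (nilN : nilpotent_alg N).
Implicit Types (x y a : N) (l m : 'Hom(N, F^o)).

Lemma normalized_exp1_translate l a m : \dim (annihilator N) = 1%N ->
  normalized l a -> m a = 1 ->
  exists d, forall x, m (exp1 x) = l (exp1 (x + d)).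
Proof.
move=> dimA la ma1; have [Aa la1 _] := la.
have [|c Ec] := functional_representation amulC nilN (m := m - l) la dimA.
  by rewrite add_lfunE opp_lfunE ma1 la1 subrr.
have [b Eb] := exp1_surj charF0 amulC nilN c.
(* Translation by [b] alone leaves the constant [l (exp1 b)]; the multiple of [a] cancels it. *)
exists (b - (l (exp1 b) : F) *: a) => x.
rewrite addrA -scaleNr exp1D_ann ?memvZ // linearD linearZ /= la1.
rewrite -[_ *: _]/(_ * 1) mulr1 exp1D // Eb [exp1 x ** c]amulC !linearD /= -Ec.
by rewrite add_lfunE opp_lfunE addrAC addrK addrC subrK.
Qed.

(** Take [m = l (exp b * _)]. It agrees with [l] on the annihilator, and [l (exp1 b) = 0] removes
    the constant term. *)
Lemma exp1_shift_functional l a b : normalized l a -> l (exp1 b) = 0 ->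
  exists2 m, normalized m a & forall x, l (exp1 (x + b)) = m (exp1 x).
Proof.
move=> [Aa la1 lA] lb; pose m := l + (l \o lmul (exp1 b))%VF.
have mE x : m x = l x + l (exp1 b ** x) by rewrite add_lfunE comp_lfunE lmulE.
have mA x : x \in annihilator N -> m x = l x.
  by move=> Ax; rewrite mE amulC (annihilatorP _ Ax) linear0 addr0.
exists m; first by split=> // [|x Ax]; rewrite mA // -lA.
by move=> x; rewrite mE exp1D // !linearD /= lb addr0 [exp1 x ** _]amulC.
Qed.

End Translation.

(** * Isomorphism versus affine equivalence *)

Lemma exp1_morph (F : fieldType) (N N' : assocAlgType F) (f : {linear N -> N'}) x :
  nilpotent_alg N -> nilpotent_alg N' -> {morph f : x y / x ** y} ->
  f (exp1 x) = exp1 (f x).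
Proof.
move=> nilN nilN' fM.
rewrite (exp1E _ nilN (leq_maxl _ (\dim {:N'}))) (exp1E _ nilN' (leq_maxr (\dim {:N}) _)).
rewrite linear_sum big_nat [RHS]big_nat; apply: eq_bigr => -[|k] // _.
rewrite linearZ /=; congr (_ *: _).
by elim: k => // k IHk; rewrite !(apowS _ (ltn0Sn k)) fM IHk.
Qed.

Theorem mainTheorem6 (F : fieldType) (charF0 : [pchar F]%R =i pred0)
    (N N' : assocAlgType F) (admN : admissible N) (admN' : admissible N')
    (p : 'End(N)) (p' : 'End(N'))
    (hp : admissible_proj p) (hp' : admissible_proj p') :
  alg_isomorphic N N' <-> affinely_equivalent (Sset p) (Sset p').
Proof.
have [l [a [la Sl]]] := admissible_functional admN hp.
have [m [a' [ma' Sm]]] := admissible_functional admN' hp'.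
have [amulC nilN dimA] := admN; have [amulC' nilN' _] := admN'.
split=> [[f [fi fK fiK] fM] | [g [[gi gK giK] [f [b gE]]] gS]].
- pose k : F := m (f a); have [Aa la1 _] := la; have [_ _ mA'] := ma'.
  have k_neq0 : k != 0.
    apply/eqP => k0; have fa0 : f a = 0.
      rewrite (mA' (f a)) -/k ?k0 ?scale0r //; apply/annihilatorP => y.
      by rewrite -[y]fiK -fM (annihilatorP _ Aa) linear0.
    move/eqP: la1; rewrite -[a]fK fa0 -[0](linear0 f) fK linear0.
    by rewrite eq_sym oner_eq0.
  (* The pullback of [m], rescaled to take the value 1 at [a]. *)
  pose mf : 'Hom(N, F^o) := k^-1 *: (m \o linfun f)%VF.
  have mfE x : m (f x) = k * mf x.
    by rewrite scale_lfunE comp_lfunE lfunE /= [RHS]mulVKf.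
  have [|d Ed] := normalized_exp1_translate charF0 amulC nilN (m := mf) dimA la.
    by apply: (mulfI k_neq0); rewrite -mfE mulr1.
  exists (fun x => f x + f (- d)).
    split; last by exists f, (f (- d)).
    exists (fun y => fi y + d) => [x|y]; first by rewrite -linearD fK subrK.
    by rewrite -linearD addrK fiK.
  have S' x : (f x \in Sset p') = (x + d \in Sset p).
    by rewrite Sm Sl -exp1_morph // mfE mulf_eq0 (negPf k_neq0) Ed.
  move=> y; rewrite -[y]fiK S'; split=> [Sy | [x Sx /eqP]].
    by exists (fi y + d); rewrite // -linearD addrK.
  by rewrite -linearD (can_eq fK) => /eqP->; rewrite subrK.
- have gSE x : (g x \in Sset p') = (x \in Sset p).
    apply/idP/idP => [/gS[x' Sx' /eqP]|Sx]; last by apply/gS; exists x.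
    by rewrite (can_eq gK) => /eqP->.
  (* The origin lies in [Sset p], so [b = g 0] lies in [Sset p']. *)
  have mb : m (exp1 b) = 0.
    have := gSE 0; rewrite gE linear0 add0r Sm Sl exp10 linear0 eqxx.
    exact: eqP.
  have [m' m'a' Em'] := exp1_shift_functional charF0 amulC' nilN' ma' mb.
  pose fi y := gi (y + b).
  have fK : cancel f fi by move=> x; rewrite /fi -gE gK.
  have fiK : cancel fi f.
    by move=> y; apply: (addIr b); rewrite -gE giK.
  pose fiL : {linear N' -> N} :=
    HB.pack fi (GRing.isLinear.Build F N' N *:%R fi (can2_linear fK fiK)).
  have lm' x : l (exp1 x) = 0 <-> m' (exp1 (f x)) = 0.
    by rewrite -Em' -gE; split=> /eqP; [rewrite -Sl -gSE Sm|rewrite -Sm gSE Sl]; move/eqP.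
  have [c Ec] := exp1_functional_proportional charF0 amulC nilN amulC' nilN'
    (g := fiL) fK fiK la m'a' lm'.
  exists f; first by exists fi.
  apply: (exp1_functional_morph charF0 amulC nilN amulC' nilN' fiK m'a').
  by exists (c *: l) => x; rewrite scale_lfunE Ec.
Qed.
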